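(* Let $1\le k<n$ and $1\le t\le n-k$ be integers. Consider an $(n,k)$ MDS-coded storage system with nodes $N_0,\dots,N_{n-1}$, in which a stripe encodes $M$ units of original data and each node stores $\frac{M}{k}$ units per stripe. Suppose that $t$ nodes fail and that the lost data of all $t$ failed nodes is recovered by a relayer from data downloaded from the surviving nodes. Then the recovery bandwidth (the total amount of data downloaded per stripe from the surviving nodes to the relayer) is bounded below by $$ \begin{cases} \dfrac{M\,t\,(n-t)}{k\,(n-k)} & \text{if } t<k,\\[2mm] M & \text{if } t\ge k . \end{cases} $$
   Context: Storage model. Fix a finite field $\mathbb{F}$ (the paper works over $\mathrm{GF}(2^8)$) and a positive integer $r$ (number of symbols per strip). A stripe of original data is a vector $x\in\mathbb{F}^{kr}$ of $kr$ original symbols, which is arbitrary. The total amount of original data in the stripe is $M$, so each symbol has size $\frac{M}{kr}$. Node $N_i$ ($0\le i\le n-1$) stores $r$ symbols $s_i=(s_{i,0},\dots,s_{i,r-1})=G_i x$, where $G_i$ is a fixed $r\times kr$ matrix over $\mathbb{F}$ (the $G_i$ together form the $nr\times kr$ generator matrix). Thus each node stores $\frac{M}{k}$ units of data. The code is MDS: for any $k$ of the $n$ nodes, $x$ is determined by the symbols stored in those $k$ nodes. Recovery. Let $F\subset\{0,\dots,n-1\}$ with $|F|=t$ be the set of failed nodes. Each surviving node $N_i$, $i\notin F$, sends to a relayer some number $b_i\ge 0$ of encoded symbols, each a fixed linear combination over $\mathbb{F}$ of the $r$ symbols stored in $N_i$, and each having the same size $\frac{M}{kr}$ as a stored symbol.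 The scheme recovers the lost data if, for every $x$, the relayer can determine all stored symbols $s_{i'}$, $i'\in F$, from the received symbols alone. The recovery bandwidth of the scheme is $\sum_{i\notin F} b_i\cdot\frac{M}{kr}$. The claim is that every such scheme (for every $r$, every such MDS code, every failure set $F$ of size $t$, and every choice of encoded symbols) has recovery bandwidth at least the displayed quantity. *)

(* Defs.v *)
From HB Require Import structures.
From mathcomp Require Import all_boot all_order all_algebra.
Set Implicit Arguments.
Unset Strict Implicit.
Unset Printing Implicit Defensive.
Import Order.TTheory GRing.Theory Num.Theory.
Local Open Scope ring_scope.

Section Storage.

Variables (F : finFieldType) (n k r : nat).

(* [G i] is the block of [r] rows of the generator matrix that belongs to
   node [i]; it need not be systematic. *)
Variable G : 'I_n -> 'M[F]_(r, k * r).

Definition stored (i : 'I_n) (x : 'cV[F]_(k * r)) : 'cV[F]_r := G i *m x.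

(* A quantity is determined by observations when any two stripes with equal
   observations give it equal values, i.e. when it is a function of them. *)
Definition MDS : Prop :=
  forall K : {set 'I_n}, #|K| = k ->
  forall x y : 'cV[F]_(k * r),
    (forall i, i \in K -> stored i x = stored i y) -> x = y.

(* The rows of [C i] are the coefficients of the [b i] encoded symbols sent by
   node [i].  For convenience [b] and [C] are given on all nodes; their values
   on failed nodes are never used. *)
Variables (b : 'I_n -> nat) (C : forall i, 'M[F]_(b i, r)).

Definition sent (i : 'I_n) (x : 'cV[F]_(k * r)) : 'cV[F]_(b i) :=
  C i *m stored i x.

Definition recovers (failed : {set 'I_n}) : Prop :=
  forall x y : 'cV[F]_(k * r),
    (forall i, i \notin failed -> sent i x = sent i y) ->
    forall j, j \in failed -> stored j x = stored j y.

End Storage.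

Definition symbol_size (R : realFieldType) (M : R) (k r : nat) : R :=
  M / (k * r)%:R.

Definition recovery_bandwidth (R : realFieldType) (M : R) (n k r : nat)
    (failed : {set 'I_n}) (b : 'I_n -> nat) : R :=
  \sum_(i | i \notin failed) (b i)%:R * symbol_size M k r.

(* Main.v *)
(* Linear algebra: if the k - t surviving nodes outside a set W were read in
   full, then together with the symbols sent by the n - k nodes of W they would
   determine the failed nodes, hence k whole nodes, hence the stripe; counting
   dimensions, W sends at least t r symbols.  Applied to the n - k survivors
   that send least, whose share of the traffic is at most (n - k) / (n - t),
   this gives the bound.  If t >= k, no extra node has to be read and the sent
   symbols alone determine the stripe. *)
Require Import Defs.
From HB Require Import structures.
From mathcomp Require Import all_boot all_order all_algebra.
From mathcomp Require Import zify.
Set Implicit Arguments.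
Unset Strict Implicit.
Unset Printing Implicit Defensive.
Import Order.TTheory GRing.Theory Num.Theory.
Local Open Scope ring_scope.

(** Each column of [cokermx B] lies in the common kernel, so the row spaces together span the whole
    space, and rank is subadditive over their sum. *)
Lemma leq_sum_rank_injective (F : fieldType) (I : finType) (P : pred I) (m : nat)
    (A : I -> 'M[F]_m) :
  (forall x : 'cV[F]_m, (forall i, P i -> A i *m x = 0) -> x = 0) ->
  (m <= \sum_(i | P i) \rank (A i))%N.
Proof.
move=> inj; pose B := (\sum_(i | P i) A i)%MS.
have coker0 : cokermx B = 0.
  apply/matrixP=> i j.
  have /matrixP/(_ i 0) : col j (cokermx B) = 0.
    apply: inj => l Pl; have /submxP[D ->] : (A l <= B)%MS.
      exact: (sumsmx_sup l).
    by rewrite colE mulmxA -(mulmxA D) mulmx_coker mulmx0 mul0mx.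
  by rewrite !mxE.
have := mxrank_coker B; rewrite coker0 mxrank0 => /esym/eqP.
rewrite subn_eq0 => /leq_trans; apply.
rewrite /B; elim/big_ind2: _ => [|a A1 c A2 le1 le2|//].
  by rewrite mxrank0.
exact: leq_trans (mxrank_adds_leqif _ _) (leq_add le1 le2).
Qed.

(** Starting from [S], discard a heaviest element at a time: it weighs at least the average, so the
    average never rises. *)
Lemma exists_light_subset (T : finType) (S : {set T}) (b : T -> nat) (m : nat) :
  (m <= #|S|)%N ->
  exists W : {set T}, [/\ W \subset S, #|W| = m &
    (#|S| * \sum_(i in W) b i <= m * \sum_(i in S) b i)%N].
Proof.
move: {-1}(#|S| - m)%N (erefl (#|S| - m)%N) => d.
elim: d m => [|d IHd] m def_d le_m.
  have -> : m = #|S| by lia.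
  by exists S.
have [||W [sWS cardW leW]] := IHd m.+1; try by lia.
have [w0 w0W] : exists w, w \in W by apply/card_gt0P; rewrite cardW.
have [w wW max_w] : exists2 w, w \in W & forall i, i \in W -> (b i <= b w)%N.
  by case: (arg_maxnP b w0W) => w ? ?; exists w.
have wDW := cardsD1 w W; rewrite wW in wDW.
exists (W :\ w); split; first exact: subset_trans (subD1set _ _) sWS.
  lia.
have splitW : (\sum_(i in W) b i = b w + \sum_(i in W :\ w) b i)%N.
  by rewrite (big_setD1 w).
have le_max : (\sum_(i in W :\ w) b i <= m * b w)%N.
  have -> : m = #|W :\ w| by lia.
  rewrite -sum_nat_const; apply: leq_sum => i.
  by rewrite in_setD1 => /andP[_]; apply: max_w.
(* The factor [m.+1], the size of [W], compares averages: [splitW] and [le_max] bound [m.+1] times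
   the weight of [W :\ w] by [m] times that of [W]. *)
rewrite -(leq_pmul2l (ltn0Sn m)).
nia.
Qed.

Section Bandwidth.

Variables (F : finFieldType) (n k r : nat) (G : 'I_n -> 'M[F]_(r, k * r)).
Variables (b : 'I_n -> nat) (C : forall i, 'M[F]_(b i, r)).
Variable failed : {set 'I_n}.

(** [P] is the set of survivors read in full; leaving it arbitrary, possibly empty, serves both
    cases of the bound. *)
Lemma sent_lower_bound (P : {set 'I_n}) :
  MDS G -> recovers G C failed -> P \subset ~: failed -> (k <= #|P :|: failed|)%N ->
  (k * r <= #|P| * r + \sum_(i in ~: failed :\: P) b i)%N.
Proof.
move=> mdsG recC sPF lek.
(* Blocks of different heights become square matrices with the same row space, hence the same rank
   and kernel. *)
pose A i : 'M[F]_(k * r) := (if i \in P then <<G i>> else <<C i *m G i>>)%MS.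
have gen0 p (D : 'M[F]_(p, k * r)) (x : 'cV_(k * r)) : <<D>>%MS *m x = 0 -> D *m x = 0.
  have /submxP[E {2}->] : (D <= <<D>>)%MS by rewrite genmxE.
  by rewrite -mulmxA => ->; rewrite mulmx0.
have inj (x : 'cV_(k * r)) : (forall i, i \in ~: failed -> A i *m x = 0) -> x = 0.
  move=> Ax0.
  have Px0 i : i \in P -> G i *m x = 0.
    by move=> iP; apply: gen0; have := Ax0 i (subsetP sPF i iP); rewrite /A iP.
  have Fx0 j : j \in failed -> G j *m x = 0.
    (* By linearity it suffices to compare [x] with the zero stripe. *)
    move=> jF; rewrite -[RHS](mulmx0 _ (G j)).
    apply: (recC x 0) jF => i iF; rewrite /sent /stored mulmx0 mulmx0 mulmxA.
    have := Ax0 i; rewrite inE iF /A; case: ifP => [iP _|_ /(_ isT)/gen0 //].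
    by rewrite -mulmxA Px0 ?mulmx0.
  have [K sK cardK] : exists2 K : {set 'I_n}, K \subset P :|: failed & #|K| = k.
    (* With zero weights this only selects [k] elements. *)
    have [K [? ? _]] := exists_light_subset (fun=> 0%N) lek; by exists K.
  apply: (mdsG K cardK) => i /(subsetP sK); rewrite /stored mulmx0 inE.
  by case/orP; [apply: Px0 | apply: Fx0].
apply: leq_trans (leq_sum_rank_injective inj) _.
rewrite (big_setID P) /= (setIidPr sPF) leq_add //.
  rewrite -sum_nat_const; apply: leq_sum => i iP.
  by rewrite /A iP mxrank_gen rank_leq_row.
apply: leq_sum => i; rewrite inE => /andP[/negbTE iP _].
by rewrite /A iP mxrank_gen rank_leq_row.
Qed.

End Bandwidth.

Theorem theorem1 (R : realFieldType) (F : finFieldType) (n k t r : nat) (M : R)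
    (hk : (1 <= k)%N) (hkn : (k < n)%N)
    (ht : (1 <= t)%N) (htn : (t <= n - k)%N)
    (hr : (0 < r)%N) (hM : 0 < M)
    (G : 'I_n -> 'M[F]_(r, k * r)) (hG : MDS G)
    (failed : {set 'I_n}) (hfailed : #|failed| = t)
    (b : 'I_n -> nat) (C : forall i : 'I_n, 'M[F]_(b i, r))
    (hC : recovers G C failed) :
  (if (t < k)%N
   then M * t%:R * (n%:R - t%:R) / (k%:R * (n%:R - k%:R))
   else M)
  <= recovery_bandwidth M k r failed b.
Proof.
pose s := (\sum_(i in ~: failed) b i)%N.
have -> : recovery_bandwidth M k r failed b = s%:R * (M / (k * r)%:R).
  rewrite /recovery_bandwidth -mulr_suml /s natr_sum.
  by congr (_ * _); apply: eq_bigl => i; rewrite inE.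
have kr_gt0 : 0 < (k * r)%:R :> R by rewrite ltr0n muln_gt0 hk.
rewrite mulrA ler_pdivlMr //; case: ltnP => [ltk|gek]; last first.
  have := sent_lower_bound (P := set0) hG hC (sub0set _).
  rewrite set0U setD0 cards0 hfailed => /(_ gek) le_s.
  by rewrite mulrC ler_pM2r // ler_nat.
have cardS : #|~: failed| = (n - t)%N by rewrite cardsCs setCK hfailed card_ord.
have [|W [sWS cardW leW]] := @exists_light_subset _ (~: failed) b (n - k).
  by rewrite cardS; lia.
have le_sW : (t * r <= \sum_(i in W) b i)%N.
  (* These [(n - t) - (n - k)] nodes and the [t] failed ones make exactly [k]. *)
  have cardP : #|~: failed :\: W| = (k - t)%N.
    by rewrite cardsDS // cardS cardW; lia.
  have := sent_lower_bound (P := ~: failed :\: W) hG hC (subsetDl _ _).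
  rewrite cardsU cardP hfailed setDDr setDv set0U (setIidPr sWS).
  have -> : (~: failed :\: W) :&: failed = set0.
    by apply/setP=> i; rewrite !inE; case: (i \in failed); rewrite ?andbF.
  rewrite cards0; nia.
rewrite cardS in leW.
have le_s : (t * r * (n - t) <= (n - k) * s)%N by rewrite /s; nia.
rewrite -!natrB; try by lia.
rewrite mulrAC ler_pdivrMr -?natrM ?ltr0n; last by nia.
(* With denominators cleared, both sides are [M] times a natural number, and what remains is [le_s]
   scaled by [k]. *)
rewrite [X in X <= _](_ : _ = M * (k * (t * r * (n - t)))%:R); last first.
  by rewrite -!mulrA -!natrM; congr (_ * _%:R); lia.
rewrite [X in _ <= X](_ : _ = M * (k * ((n - k) * s))%:R); last first.
  by rewrite [_ * M]mulrC -mulrA -natrM; congr (_ * _%:R); lia.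
by rewrite ler_pM2l // ler_nat leq_mul2l le_s orbT.
Qed.
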